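(* Let $(X,A;f)$ and $(Y,B;g)$ be objects of $\mathcal{F}_0$ and let $\varphi,\psi\colon(X,A;f)\to(Y,B;g)$ be morphisms in $\mathcal{F}_0$. If $\varphi$ and $\psi$ are fiberwise homotopic, then $h(\varphi)=h(\psi)$.
   Context: Fix a field $K$; homology is singular homology with coefficients in $K$. A map $f\colon X\to\mathbb{R}$ on a finite simplicial complex is piecewise linear if it is linear on each simplex of some subdivision. $\mathrm{vect}_K$ is the category of finite-dimensional $K$-vector spaces. **Category $\mathcal{F}_0$.** Objects are triples $(X,A;f)$ with $X$ a finite simplicial complex, $A\subseteq X$ a subcomplex, $f\colon X\to\mathbb{R}$ piecewise linear. A morphism $\varphi\colon(X,A;f)\to(Y,B;g)$ is a continuous map $\varphi\colon X\to Y$ with $\varphi(A)\subseteq B$ and $g\circ\varphi=f$. A fiberwise homotopy from $\varphi$ to $\psi$ is a morphism $\eta\colon(X\times[0,1],A\times[0,1];f\circ\operatorname{pr}_1)\to(Y,B;g)$ in $\mathcal{F}_0$ with $\eta(-,0)=\varphi$ and $\eta(-,1)=\psi$; if one exists, $\varphi$ and $\psi$ are fiberwise homotopic. **Strip.** $\mathbb{M}=\{(x,y)\in\mathbb{R}^2 : -\pi\le x+y\le\pi\}$ with partial order $(x,y)\preceq(x',y')$ iff $x\ge x'$ and $y\le y'$; $\partial\mathbb{M}=\{x+y=-\pi\}\cup\{x+y=\pi\}$. $T(x,y)=(-\pi-y,\pi-x)$ is an automorphism of this poset. Let $D=\{(x,y)\in\mathbb{M}: 0\le y-x<2\pi\}$;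 the sets $T^{-n}(D)$, $n\in\mathbb{Z}$, partition $\mathbb{M}$. For $u=(x,y)\in D$ let $C_u\subseteq I_u$ be the closed subsets of $[-\infty,\infty]$ given by $I_u=\{t: x\le\arctan t\le y\}$, $C_u=\{t:\arctan t\le-\pi-x\text{ or }\arctan t\ge\pi-y\}$, with $\arctan(\pm\infty)=\pm\pi/2$. **Relative interlevel set homology.** For $(X,A;f)$ in $\mathcal{F}_0$ put $F(u)=\bigl(f^{-1}(I_u),\,(A\cap f^{-1}(I_u))\cup f^{-1}(C_u)\bigr)$ for $u\in D$. The functor $h(X,A;f)\colon\mathbb{M}\to\mathrm{vect}_K$ has value $H_n(F(T^n(u)))$ at $u\in T^{-n}(D)$. For $u\preceq v$ in the same tile $T^{-n}(D)$ the structure map is induced by inclusion. For $u\preceq v$ in different tiles: if $[u,v]\cap\partial\mathbb{M}\ne\emptyset$ the map is $0$; otherwise there is $n$ with $u\in T^{-n-1}(D)$, $v\in T^{-n}(D)$, and with $v'=T^n(v)=(v_1',v_2')$, $w'=T^{n+1}(u)=(w_1',w_2')$ in $D$ one has $v'\preceq w'$, $F(w')$ is the componentwise union and $F(v')$ the componentwise intersection of $F(w_1',v_2')$ and $F(v_1',w_2')$, and the map is the connecting homomorphism $H_{n+1}(F(w'))\to H_n(F(v'))$ of the corresponding relative Mayer–Vietoris sequence (with a uniformly fixed sign convention). A morphism $\varphi$ of $\mathcal{F}_0$ restricts to maps between the pairs $F(u)$ and so induces a natural transformation $h(\varphi)\colon h(X,A;f)\to h(Y,B;g)$; this makes $h$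 a functor from $\mathcal{F}_0$ to the category of functors $\mathbb{M}\to\mathrm{vect}_K$. *)

(* Defs.v *)
From HB Require Import structures.
From mathcomp Require Import all_boot all_order all_algebra.
From mathcomp Require Import all_classical all_reals all_analysis.
From mathcomp Require Import finmap ring lra zify.
From mathcomp.multinomials Require Import freeg.

Set Implicit Arguments.
Unset Strict Implicit.
Unset Printing Implicit Defensive.

Import Order.TTheory GRing.Theory Num.Theory.
Import numFieldNormedType.Exports.

Local Open Scope classical_set_scope.
Local Open Scope quotient_scope.
Local Open Scope ring_scope.

(* The quotient Z / (Z :&: B) of a submodule Z of M. The class of c : M is
   [cls c]; it is the zero class when c is not in Z. *)
Section subquotient.
Variables (K : fieldType) (M : lmodType K) (Z B : submodClosed M).

Definition submodule := {x : M | x \in Z}.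
HB.instance Definition _ := SubChoice.on submodule.
HB.instance Definition _ := [SubChoice_isSubLmodule of submodule by <:].

Definition trivial_class : {pred submodule} := fun x => val x \in B.

Lemma trivial_classE x : (x \in trivial_class) = (val x \in B).
Proof. by []. Qed.

Lemma trivial_class_zmod_closed : zmod_closed trivial_class.
Proof.
split=> [|x y]; rewrite !trivial_classE ?raddf0 ?rpred0 //.
by rewrite raddfB => xB yB; rewrite -scaleN1r rpredD ?rpredZ.
Qed.

HB.instance Definition _ :=
  GRing.isZmodClosed.Build submodule trivial_class trivial_class_zmod_closed.

Definition subquotient := Quotient.quot trivial_class.
HB.instance Definition _ := GRing.Zmodule.on subquotient.

Definition pi_sq (x : submodule) : subquotient := \pi_(Quotient.quot trivial_class) x.
Definition scale_sq (a : K) (x : subquotient) : subquotient :=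
  pi_sq (a *: repr (x : Quotient.quot trivial_class)).

Lemma pi_sqP (x y : submodule) : pi_sq x = pi_sq y <-> val x - val y \in B.
Proof.
rewrite -raddfB -trivial_classE Quotient.idealrBE.
by split=> [h|/eqP //]; apply/eqP.
Qed.

Lemma pi_sqD (x y : submodule) : pi_sq (x + y) = pi_sq x + pi_sq y.
Proof. exact: (raddfD (\pi_(Quotient.quot trivial_class))). Qed.

Lemma repr_sqK (x : subquotient) : pi_sq (repr (x : Quotient.quot trivial_class)) = x.
Proof. exact: reprK. Qed.

Lemma scale_pi_sq (a : K) (x : submodule) : scale_sq a (pi_sq x) = pi_sq (a *: x).
Proof.
apply/pi_sqP.
have -> : val (a *: repr (pi_sq x : Quotient.quot trivial_class)) - val (a *: x)
   = a *: (val (repr (pi_sq x : Quotient.quot trivial_class)) - val x).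
  by rewrite scalerBr.
by apply: rpredZ; apply/pi_sqP; rewrite repr_sqK.
Qed.

Lemma scale_sqA a b v : scale_sq a (scale_sq b v) = scale_sq (a * b) v.
Proof. by rewrite -[v]repr_sqK !scale_pi_sq scalerA. Qed.
Lemma scale_sq1 : left_id 1 scale_sq.
Proof. by move=> v; rewrite -[v]repr_sqK !scale_pi_sq scale1r. Qed.
Lemma scale_sqDr : right_distributive scale_sq +%R.
Proof.
move=> a u v; rewrite -[u]repr_sqK -[v]repr_sqK.
by rewrite -pi_sqD !scale_pi_sq -pi_sqD scalerDr.
Qed.
Lemma scale_sqDl v : {morph scale_sq^~ v : a b / a + b}.
Proof.
by move=> a b; rewrite -[v]repr_sqK !scale_pi_sq -pi_sqD scalerDl.
Qed.

HB.instance Definition _ := GRing.Zmodule_isLmodule.Build K subquotient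
  scale_sqA scale_sq1 scale_sqDr scale_sqDl.

Definition cls (c : M) : subquotient := pi_sq (insubd (0 : submodule) c).
Definition rep (x : subquotient) : M := val (repr (x : Quotient.quot trivial_class)).

Lemma rep_in x : rep x \in Z. Proof. exact: valP. Qed.
Lemma repK x : cls (rep x) = x.
Proof. by rewrite /cls /rep valKd repr_sqK. Qed.
Lemma clsP c c' : c \in Z -> c' \in Z -> cls c = cls c' <-> c - c' \in B.
Proof. by move=> cZ c'Z; rewrite pi_sqP !val_insubd cZ c'Z. Qed.
Lemma cls_linear a c c' : c \in Z -> c' \in Z ->
  cls (a *: c + c') = a *: cls c + cls c'.
Proof.
move=> cZ c'Z.
have -> : a *: cls c + cls c' =
    pi_sq (a *: insubd (0 : submodule) c + insubd (0 : submodule) c').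
  by rewrite pi_sqD -scale_pi_sq.
apply/pi_sqP; rewrite [X in _ - X](_ : _ = a *: c + c').
  have h : a *: c + c' \in Z by rewrite rpredD ?rpredZ.
  by rewrite val_insubd h subrr rpred0.
rewrite [LHS](_ : _ = a *: val (insubd (0 : submodule) c) +
                      val (insubd (0 : submodule) c')) //.
by rewrite !val_insubd cZ c'Z.
Qed.

End subquotient.

(* [sq_map g] sends the class of a representative to the class of its image; it
   is the induced linear map when g sends Z to Z' and B to B'. *)
Section subquotient_map.
Variables (K : fieldType) (M M' : lmodType K).
Variables (Z B : submodClosed M) (Z' B' : submodClosed M').

Definition sq_map (g : M -> M') (x : subquotient Z B) : subquotient Z' B' :=
  cls Z' B' (g (rep x)).

Variable g : M -> M'.
Hypothesis g_linear : linear g.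
Hypothesis gZ : {in Z, forall c, g c \in Z'}.
Hypothesis gB : {in B, forall c, g c \in B'}.

Lemma sq_map_cls c : c \in Z -> sq_map g (cls Z B c) = cls Z' B' (g c).
Proof.
move=> cZ; apply/clsP; rewrite ?gZ ?rep_in //.
have -> : g (rep (cls Z B c)) - g c = g (rep (cls Z B c) - c).
  by rewrite addrC -scaleN1r -g_linear scaleN1r addrC.
apply: gB; apply/(@clsP _ _ Z); rewrite ?rep_in //.
by rewrite repK.
Qed.

Lemma sq_map_linear : linear (sq_map g).
Proof.
move=> a x y; rewrite -[x in LHS]repK -[y in LHS]repK -cls_linear ?rep_in //.
rewrite sq_map_cls ?rpredD ?rpredZ ?rep_in // g_linear cls_linear //.
  by apply/gZ/rep_in.
by apply/gZ/rep_in.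
Qed.

End subquotient_map.

Section singular_homology.
Variables (R : realType) (K : fieldType).

Definition std_simplex (n : nat) : set 'rV[R]_n.+1 :=
  [set x | (forall i, 0 <= x ord0 i) /\ \sum_i x ord0 i = 1].
Arguments std_simplex : clear implicits.

Definition face_row n (i : 'I_n.+2) (x : 'rV[R]_n.+1) : 'rV[R]_n.+2 :=
  \row_j if unlift i j is Some k then x ord0 k else 0.

Lemma face_row_simplex n (i : 'I_n.+2) (x : 'rV[R]_n.+1) :
  std_simplex n x -> std_simplex n.+1 (face_row i x).
Proof.
move=> [x0 x1]; split=> [j|]; first by rewrite mxE; case: unlift.
rewrite (bigD1_ord i) //= mxE unlift_none add0r -x1.
by apply: eq_bigr => k _; rewrite mxE liftK.
Qed.

Definition coface n (i : 'I_n.+2) (x : std_simplex n) : std_simplex n.+1 :=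
  exist _ (face_row i (val x)) (mem_set (face_row_simplex i (set_mem (valP x)))).

Lemma coface_continuous n (i : 'I_n.+2) : continuous (@coface n i).
Proof.
apply: continuous_comp_initial => x A [P nP PA].
apply: (@filterS _ (nbhs x) _
  (fun y => forall j : 'I_n.+2, P ord0 j (face_row i (val y) ord0 j))).
  by move=> y hy; apply: PA => a b; rewrite ord1; exact: hy.
apply: (@filter_forall _ _
  (fun j y => P ord0 j (face_row i (val y) ord0 j)) (nbhs x)) => j.
have nPj : nbhs (if unlift i j is Some k then val x ord0 k else 0) (P ord0 j).
  by have := nP ord0 j; rewrite /= mxE.
suff h : nbhs x (fun y : std_simplex n =>
    P ord0 j (if unlift i j is Some k then val y ord0 k else 0)).
  by apply: filterS h => y; rewrite mxE.
case: (unlift i j) nPj => [k|] nPj; last first.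
  by apply: filterE => y; exact: nbhs_singleton nPj.
apply: (@continuous_comp _ _ _ (set_val : std_simplex n -> 'rV[R]_n.+1)
  (fun y : 'rV[R]_n.+1 => y ord0 k)) nPj.
  exact: initial_continuous.
exact: coord_continuous.
Qed.
HB.instance Definition _ n i := @isContinuous.Build
  (std_simplex n) (std_simplex n.+1) (@coface n i) (@coface_continuous n i).

Definition face (T : topologicalType) n (i : 'I_n.+2)
    (s : continuousType (std_simplex n.+1) T) : continuousType (std_simplex n) T :=
  s \o @coface n i.

Definition singular_simplex (T : topologicalType) :=
  {n : nat & continuousType (std_simplex n) T}.

(* All degrees at once: [chain T] is the direct sum over n of the free modules on
   the singular n-simplices of T, and [chains_in n U] is the submodule of the
   singular n-chains of the subspace U. *)
Definition chain (T : topologicalType) := {freeg (singular_simplex T) / K}.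

Definition simplex_boundary (T : topologicalType) (s : singular_simplex T) :
    chain T :=
  match s with
  | existT n.+1 s => \sum_(i < n.+2) (-1) ^+ i *:
     << existT (fun n => continuousType (std_simplex n) T) n (face i s) >>
  | existT 0 _ => 0
  end.

Definition boundary (T : topologicalType) : chain T -> chain T :=
  fglift (@simplex_boundary T).

Definition simplex_push (T T' : topologicalType) (f : continuousType T T')
    (s : singular_simplex T) : singular_simplex T' :=
  existT _ (tag s) (f \o tagged s : continuousType (std_simplex (tag s)) T').

Definition push (T T' : topologicalType) (f : continuousType T T') :
    chain T -> chain T' :=
  fglift (fun s => << simplex_push f s >>).

Definition chains_in (T : topologicalType) (n : int) (U : set T) :
    {pred chain T} := fun c =>
  `[< forall s, coeff s c != 0 ->
        (tag s)%:Z = n /\ forall p, U (tagged s p) >].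

Lemma fglift_linear (T : choiceType) (M : lmodType K) (f : T -> M) :
  linear (fglift f : {freeg T / K} -> M).
Proof.
have add := lift_is_additive f.
have f0 : fglift f 0 = 0 by rewrite -(subr0 0) add subrr.
have fN x : fglift f (- x) = - fglift f x by rewrite -sub0r add f0 sub0r.
have fD x y : fglift f (x + y) = fglift f x + fglift f y.
  by rewrite -{1}[y]opprK add fN opprK.
have fsum (s : seq T) (F : T -> {freeg T / K}) :
    fglift f (\sum_(z <- s) F z) = \sum_(z <- s) fglift f (F z).
  exact: (big_morph _ fD f0).
move=> a x y; rewrite fD; congr (_ + _).
rewrite -[x]freeg_sumE scaler_sumr !fsum scaler_sumr.
apply: eq_bigr => z _.
have -> : a *: << coeff z x *g z >> = << a * coeff z x *g z >> :> {freeg T / K}.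
  by apply/eqP/freeg_eqP => t; rewrite coeffZ !coeffU mulrA.
by rewrite !liftU scalerA.
Qed.

Section fixed_space.
Variable T : topologicalType.

Lemma boundary_linear : linear (@boundary T).
Proof. exact: fglift_linear. Qed.

Lemma chains_inP n (U : set T) c : reflect
  (forall s : singular_simplex T, coeff s c != 0 ->
     (tag s)%:Z = n /\ forall p, U (tagged s p))
  (c \in chains_in n U).
Proof. exact: asboolP. Qed.

Lemma chains_in_closed n U : submod_closed (@chains_in T n U).
Proof.
split=> [|a x y /chains_inP xU /chains_inP yU]; apply/chains_inP => s.
  by rewrite coeff0 eqxx.
rewrite coeffD coeffZ => axy.
have [y0|/yU//] := eqVneq (coeff s y) 0; apply: xU.
by apply: contraNneq axy => ->; rewrite y0 mulr0 addr0.
Qed.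
HB.instance Definition _ n U := GRing.isSubmodClosed.Build K (chain T)
  (@chains_in T n U) (@chains_in_closed n U).

(* A pair P stands for the pair of subspaces (P.1, P.2) of T with P.2 contained in
   P.1; [homology n P] is the homology of the quotient complex S(P.1) / S(P.2),
   which is zero in degrees n < 0. *)
Implicit Types P : set T * set T.

Definition rel_cycles (n : int) P : {pred chain T} := fun c =>
  (c \in chains_in n P.1) && (boundary c \in chains_in (n - 1) P.2).

Definition rel_boundaries (n : int) P : {pred chain T} := fun c =>
  `[< exists w a, [/\ w \in chains_in (n + 1) P.1, a \in chains_in n P.2
                    & c = boundary w + a] >].

Lemma rel_cyclesP n P c : reflect
  (c \in chains_in n P.1 /\ boundary c \in chains_in (n - 1) P.2)
  (c \in rel_cycles n P).
Proof. exact: andP. Qed.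

Lemma rel_boundariesP n P c : reflect
  (exists w a, [/\ w \in chains_in (n + 1) P.1, a \in chains_in n P.2
                 & c = boundary w + a])
  (c \in rel_boundaries n P).
Proof. exact: asboolP. Qed.

Lemma boundary0 : boundary 0 = 0 :> chain T.
Proof. by have := boundary_linear (-1) 0 0; rewrite !scaleN1r addr0 oppr0 addNr. Qed.

Lemma rel_cycles_closed n P : submod_closed (rel_cycles n P).
Proof.
split=> [|a x y /rel_cyclesP[x1 x2] /rel_cyclesP[y1 y2]]; apply/rel_cyclesP.
  by rewrite boundary0 !rpred0.
by rewrite boundary_linear !rpredD ?rpredZ.
Qed.
HB.instance Definition _ n P := GRing.isSubmodClosed.Build K (chain T)
  (rel_cycles n P) (@rel_cycles_closed n P).

Lemma rel_boundaries_closed n P : submod_closed (rel_boundaries n P).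
Proof.
split=> [|a x y /rel_boundariesP[w [b [wU bV ->]]]
                /rel_boundariesP[w' [b' [w'U b'V ->]]]]; apply/rel_boundariesP.
  by exists 0, 0; rewrite boundary0 addr0 !rpred0.
exists (a *: w + w'), (a *: b + b').
by rewrite boundary_linear scalerDr addrACA !rpredD ?rpredZ.
Qed.
HB.instance Definition _ n P := GRing.isSubmodClosed.Build K (chain T)
  (rel_boundaries n P) (@rel_boundaries_closed n P).

Definition homology (n : int) P : lmodType K :=
  subquotient (rel_cycles n P) (rel_boundaries n P).

Definition hclass n P (c : chain T) : homology n P :=
  cls (rel_cycles n P) (rel_boundaries n P) c.

End fixed_space.

Definition hmap (T T' : topologicalType) n P n' P'
    (g : chain T -> chain T') (x : homology n P) : homology n' P' :=
  hclass n' P' (g (rep x)).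

End singular_homology.
Arguments hmap {R K T T' n P n' P'} g x.
Arguments hclass {R K T} n P c.
Arguments homology R K {T} n P.

Section maps_on_homology.
Variables (R : realType) (K : fieldType).

Definition sub_pair (T : Type) (P Q : set T * set T) :=
  P.1 `<=` Q.1 /\ P.2 `<=` Q.2.

Lemma chains_in_mono (T : topologicalType) n n' (U U' : set T) (c : chain R K T) :
  n = n' -> U `<=` U' -> c \in chains_in n U -> c \in chains_in n' U'.
Proof.
move=> <- UU' /chains_inP cU; apply/chains_inP => s /cU[tn sU]; split=> // p.
exact/UU'/sU.
Qed.

Section inclusion.
Variables (T : topologicalType) (n n' : int) (P P' : set T * set T).
Hypotheses (nn' : n = n') (PP' : sub_pair P P').

Lemma rel_cycles_mono (c : chain R K T) :
  c \in rel_cycles n P -> c \in rel_cycles n' P'.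
Proof.
have [s1 s2] := PP'.
move=> /rel_cyclesP[h1 h2]; apply/rel_cyclesP; split.
  exact: chains_in_mono h1.
by apply: chains_in_mono h2; rewrite ?nn'.
Qed.

Lemma rel_boundaries_mono (c : chain R K T) :
  c \in rel_boundaries n P -> c \in rel_boundaries n' P'.
Proof.
have [s1 s2] := PP'.
move=> /rel_boundariesP[w [a [h1 h2 ->]]]; apply/rel_boundariesP.
exists w, a; split=> //; first by apply: chains_in_mono h1; rewrite ?nn'.
exact: chains_in_mono h2.
Qed.

Lemma incl_linear : linear (hmap id : homology R K n P -> homology R K n' P').
Proof.
apply: sq_map_linear => // c; [exact: rel_cycles_mono|exact: rel_boundaries_mono].
Qed.

Lemma hclass0 : hclass n P 0 = 0 :> homology R K n P.
Proof.
have := @cls_linear _ _ (@rel_cycles R K T n P)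
  (@rel_boundaries R K T n P) (-1) 0 0 (rpred0 _) (rpred0 _).
by rewrite addr0 scaler0 scaleN1r addNr.
Qed.

Lemma incl_class c : c \in rel_cycles n P ->
  hmap id (hclass n P c) = hclass n' P' c :> homology R K n' P'.
Proof.
move=> cZ; apply: (@sq_map_cls K _ _ _ _ _ _ id) => // d.
  exact: rel_cycles_mono.
exact: rel_boundaries_mono.
Qed.

End inclusion.
Arguments hclass0 {T} n P.

Lemma incl_incl (T : topologicalType) n n' n'' (P P' P'' : set T * set T)
    (x : homology R K n P) : n = n' -> n' = n'' ->
  sub_pair P P' -> sub_pair P' P'' ->
  hmap id (hmap id x : homology R K n' P') = hmap id x :> homology R K n'' P''.
Proof.
move=> nn' nn'' PP' PP''.
rewrite [hmap id x in LHS](_ : _ = hclass n' P' (rep x)) // incl_class //.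
exact/(rel_cycles_mono nn' PP')/rep_in.
Qed.

Lemma incl_id (T : topologicalType) n (P : set T * set T)
    (x : homology R K n P) : hmap id x = x.
Proof. exact: repK. Qed.

Section pushforward.
Variables (T T' : topologicalType) (f : continuousType T T').
Local Notation push := (@push R K T T' f).

Lemma push_linear : linear push.
Proof. exact: fglift_linear. Qed.

Lemma push0 : push 0 = 0.
Proof. by have := push_linear (-1) 0 0; rewrite !scaleN1r addr0 oppr0 addNr. Qed.

Lemma pushZ k x : push (k *: x) = k *: push x.
Proof. by have := push_linear k x 0; rewrite push0 !addr0. Qed.

Lemma push_sum (I : Type) (r : seq I) (F : I -> chain R K T) :
  push (\sum_(i <- r) F i) = \sum_(i <- r) push (F i).
Proof.
by apply: (big_morph _ _ push0) => x y; have := push_linear 1 x y; rewrite !scale1r.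
Qed.

Lemma pushU (k : K) s : push << k *g s >> = << k *g simplex_push f s >>.
Proof.
rewrite [LHS]liftU; apply/eqP/freeg_eqP => t.
by rewrite coeffZ !coeffU mul1r.
Qed.

Lemma chains_in_push n (U : set T) (U' : set T') c :
  (forall p, U p -> U' (f p)) ->
  c \in chains_in n U -> push c \in chains_in n U'.
Proof.
move=> UU' /chains_inP cU; rewrite -[c]freeg_sumE push_sum.
rewrite big_seq rpred_sum // => s; rewrite mem_dom => /cU [tn sU].
rewrite pushU; apply/chains_inP => t; rewrite coeffU.
have [<- _|] := eqVneq (simplex_push f s) t; last by rewrite mulr0 eqxx.
by split=> // p; apply/UU'/sU.
Qed.

Lemma push_boundary (c : chain R K T) : push (boundary c) = boundary (push c).
Proof.
rewrite -[c]freeg_sumE push_sum.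
have bD : {morph @boundary R K T : x y / x + y >-> x + y}.
  by move=> x y; have := boundary_linear 1 x y; rewrite !scale1r.
have bD' : {morph @boundary R K T' : x y / x + y >-> x + y}.
  by move=> x y; have := boundary_linear 1 x y; rewrite !scale1r.
rewrite (big_morph _ bD (boundary0 _ _ _)) (big_morph _ bD' (boundary0 _ _ _)).
rewrite push_sum; apply: eq_bigr => s _.
rewrite pushU /boundary !liftU.

rewrite pushZ.
congr (_ *: _); case: s => -[|n] s /=.
  by rewrite -(scale0r 0) pushZ scale0r.
rewrite push_sum; apply: eq_bigr => i _.
rewrite pushZ pushU; congr (_ *: << _ >>).
by rewrite /simplex_push /=; congr existT; apply/continuousEP.
Qed.

Variables (n : int) (P : set T * set T) (P' : set T' * set T').
Hypothesis fP1 : forall p, P.1 p -> P'.1 (f p).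
Hypothesis fP2 : forall p, P.2 p -> P'.2 (f p).

Lemma rel_cycles_push c : c \in rel_cycles n P -> push c \in rel_cycles n P'.
Proof.
move=> /rel_cyclesP[h1 h2]; apply/rel_cyclesP.
by rewrite -push_boundary; split; [exact: chains_in_push h1|exact: chains_in_push h2].
Qed.

Lemma rel_boundaries_push c :
  c \in rel_boundaries n P -> push c \in rel_boundaries n P'.
Proof.
move=> /rel_boundariesP[w [a [h1 h2 ->]]]; apply/rel_boundariesP.
exists (push w), (push a); rewrite -push_boundary; split.
- exact: chains_in_push h1.
- exact: chains_in_push h2.
- by have := push_linear 1 (boundary w) a; rewrite !scale1r.
Qed.

Lemma hmap_push_linear :
  linear (hmap push : homology R K n P -> homology R K n P').
Proof.
apply: sq_map_linear.
- exact: push_linear.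
- exact: rel_cycles_push.
- exact: rel_boundaries_push.
Qed.

Lemma hmap_push_class c : c \in rel_cycles n P ->
  hmap push (hclass n P c) = hclass n P' (push c) :> homology R K n P'.
Proof.
move=> cZ; apply: (@sq_map_cls K _ _ _ _ _ _ push) => //.
- exact: push_linear.
- exact: rel_cycles_push.
- exact: rel_boundaries_push.
Qed.

End pushforward.

Section mayer_vietoris.
Variable T : topologicalType.

(* The graph of the connecting homomorphism of the relative Mayer-Vietoris
   sequence of P1 and P2, for PU their union, PI their intersection (both
   componentwise) and m = n + 1: a class x of PU with a representative z1 + z2,
   z1 in P1 and z2 in P2, whose boundary is a1 + a2 with a1 in P1.2 and a2 in P2.2,
   is sent to the class of boundary z1 - a1 = - (boundary z2 - a2). *)
Definition mv_zigzag (m n : int) (PU P1 P2 PI : set T * set T)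
    (x : homology R K m PU) (y : homology R K n PI) : Prop :=
  exists z1 z2 a1 a2 : chain R K T,
    [/\ z1 \in chains_in m P1.1 /\ a1 \in chains_in n P1.2,
        z2 \in chains_in m P2.1 /\ a2 \in chains_in n P2.2,
        boundary z1 + boundary z2 = a1 + a2,
        z1 + z2 \in rel_cycles m PU /\ hclass m PU (z1 + z2) = x &
        boundary z1 - a1 \in rel_cycles n PI /\
          hclass n PI (boundary z1 - a1) = y].

Lemma mv_zigzag_linear m n PU P1 P2 PI a x y x' y' :
  @mv_zigzag m n PU P1 P2 PI x y -> mv_zigzag P1 P2 x' y' ->
  mv_zigzag P1 P2 (a *: x + x') (a *: y + y').
Proof.
move=> [z1 [z2 [a1 [a2 [[h1 h2] [h3 h4] h5 [h6 <-] [h7 <-]]]]]].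
move=> [t1 [t2 [b1 [b2 [[g1 g2] [g3 g4] g5 [g6 <-] [g7 <-]]]]]].
exists (a *: z1 + t1), (a *: z2 + t2), (a *: a1 + b1), (a *: a2 + b2).
rewrite !boundary_linear.
have e1 : a *: z1 + t1 + (a *: z2 + t2) = a *: (z1 + z2) + (t1 + t2).
  by rewrite scalerDr addrACA.
have e2 : a *: boundary z1 + boundary t1 - (a *: a1 + b1) =
          a *: (boundary z1 - a1) + (boundary t1 - b1).
  by rewrite scalerBr opprD addrACA.
rewrite e1 e2; split.
- by split; rewrite rpredD ?rpredZ.
- by split; rewrite rpredD ?rpredZ.
- by rewrite addrACA -scalerDr h5 g5 scalerDr addrACA.
- by rewrite rpredD ?rpredZ // /hclass cls_linear.
- by rewrite rpredD ?rpredZ // /hclass cls_linear.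
Qed.

Lemma mv_zigzag_mono m n m' n' PU P1 P2 PI PU' P1' P2' PI' x y :
  m = m' -> n = n' -> sub_pair PU PU' -> sub_pair P1 P1' ->
  sub_pair P2 P2' -> sub_pair PI PI' ->
  @mv_zigzag m n PU P1 P2 PI x y ->
  @mv_zigzag m' n' PU' P1' P2' PI' (hmap id x) (hmap id y).
Proof.
move=> mm nn sU [s1 s1'] [s2 s2'] sI.
move=> [z1 [z2 [a1 [a2 [[h1 h2] [h3 h4] h5 [h6 <-] [h7 <-]]]]]].
exists z1, z2, a1, a2; rewrite !incl_class //; split=> //.
- by split; [exact: chains_in_mono h1|exact: chains_in_mono h2].
- by split; [exact: chains_in_mono h3|exact: chains_in_mono h4].
- by split=> //; exact: rel_cycles_mono h6.
- by split=> //; exact: rel_cycles_mono h7.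
Qed.

Lemma mv_zigzag_left m n PU0 PU P1 P2 PI c : m = n + 1 :> int ->
  sub_pair PU0 PU -> sub_pair PU0 P1 -> c \in rel_cycles m PU0 ->
  @mv_zigzag m n PU P1 P2 PI (hclass m PU c) 0.
Proof.
move=> mn sU [s1 s2] cZ; have [c1 c2] := rel_cyclesP _ _ _ cZ.
exists c, 0, (boundary c), 0; rewrite boundary0 !addr0 subrr; split=> //.
- split; first exact: chains_in_mono c1.
  by apply: chains_in_mono c2; rewrite ?mn ?addrK.
- by rewrite !rpred0.
- by split=> //; exact: rel_cycles_mono cZ.
- by rewrite rpred0 hclass0.
Qed.

Lemma mv_zigzag_right m n PU0 PU P1 P2 PI c : m = n + 1 :> int ->
  sub_pair PU0 PU -> sub_pair PU0 P2 -> c \in rel_cycles m PU0 ->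
  @mv_zigzag m n PU P1 P2 PI (hclass m PU c) 0.
Proof.
move=> mn sU [s1 s2] cZ; have [c1 c2] := rel_cyclesP _ _ _ cZ.
exists 0, c, 0, (boundary c); rewrite boundary0 !add0r oppr0; split=> //.
- by rewrite !rpred0.
- split; first exact: chains_in_mono c1.
  by apply: chains_in_mono c2; rewrite ?mn ?addrK.
- by split=> //; exact: rel_cycles_mono cZ.
- by rewrite rpred0 hclass0.
Qed.

Lemma mv_zigzag_incl0 m n n' PU P1 P2 PI PI' x y : m = n + 1 :> int -> n = n' ->
  sub_pair PI PI' -> sub_pair P1 PI' \/ sub_pair P2 PI' ->
  @mv_zigzag m n PU P1 P2 PI x y -> hmap id y = 0 :> homology R K n' PI'.
Proof.
move=> mn <- sI s12 [z1 [z2 [a1 [a2 [[h1 h2] [h3 h4] h5 _ [h7 <-]]]]]].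
rewrite incl_class // -(hclass0 n PI'); apply/clsP; rewrite ?rpred0 //.
  exact: rel_cycles_mono h7.
rewrite subr0; apply/rel_boundariesP; case: s12 => -[s1 s2].
  exists z1, (- a1); split=> //.
    by apply: chains_in_mono h1; rewrite ?mn.
  by rewrite -scaleN1r rpredZ //; exact: chains_in_mono h2.
exists (- z2), a2; split; last first.
- rewrite (_ : boundary (- z2) = - boundary z2); last first.
    have := boundary_linear (-1) z2 0.
    by rewrite boundary0 !addr0 !scaleN1r.
  have -> : boundary z1 = a2 + a1 - boundary z2 by rewrite [a2 + a1]addrC -h5 addrK.
  by rewrite addrAC addrK addrC.
- exact: chains_in_mono h4.
- rewrite -scaleN1r rpredZ //; apply: chains_in_mono h3; rewrite ?mn //.
Qed.

End mayer_vietoris.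

Lemma mv_zigzag_push (T T' : topologicalType) (f : continuousType T T')
    m n PU P1 P2 PI PU' P1' P2' PI' x y :
  (forall p, PU.1 p -> PU'.1 (f p)) -> (forall p, PU.2 p -> PU'.2 (f p)) ->
  (forall p, P1.1 p -> P1'.1 (f p)) -> (forall p, P1.2 p -> P1'.2 (f p)) ->
  (forall p, P2.1 p -> P2'.1 (f p)) -> (forall p, P2.2 p -> P2'.2 (f p)) ->
  (forall p, PI.1 p -> PI'.1 (f p)) -> (forall p, PI.2 p -> PI'.2 (f p)) ->
  @mv_zigzag T m n PU P1 P2 PI x y ->
  @mv_zigzag T' m n PU' P1' P2' PI' (hmap (push f) x) (hmap (push f) y).
Proof.
move=> U1 U2 f11 f12 f21 f22 I1 I2.
move=> [z1 [z2 [a1 [a2 [[h1 h2] [h3 h4] h5 [h6 <-] [h7 <-]]]]]].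
have pD (c d : chain R K T) : push f (c + d) = push f c + push f d.
  by have := push_linear f 1 c d; rewrite !scale1r.
have pB (c d : chain R K T) : push f (c - d) = push f c - push f d.
  by rewrite pD -scaleN1r pushZ scaleN1r.
exists (push f z1), (push f z2), (push f a1), (push f a2).
rewrite -!push_boundary -!pD -pB h5 !(hmap_push_class (P' := PU')) //
  !(hmap_push_class (P' := PI')) //.
split=> //.
- by split; [exact: chains_in_push h1|exact: chains_in_push h2].
- by split; [exact: chains_in_push h3|exact: chains_in_push h4].
- by split=> //; exact: (rel_cycles_push U1 U2).
- by split=> //; exact: (rel_cycles_push I1 I2).
Qed.
End maps_on_homology.

Section simplicial_complexes.
Variables (R : realType) (n : nat).
Implicit Types (s t : {fset 'rV[R]_n}) (S : {fset {fset 'rV[R]_n}}).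

(* A simplex is given by the finite set of its vertices. *)
Definition barycentric s (a : 'rV[R]_n -> R) : Prop :=
  (forall v, v \in s -> 0 <= a v) /\ \sum_(v <- s) a v = 1.

Definition convex_hull s : set 'rV[R]_n :=
  [set p | exists2 a, barycentric s a & p = \sum_(v <- s) a v *: v].

Definition affinely_independent s : Prop :=
  forall a : 'rV[R]_n -> R,
    \sum_(v <- s) a v = 0 -> \sum_(v <- s) a v *: v = 0 ->
    forall v, v \in s -> a v = 0.

Definition simplicial_complex S : Prop :=
  [/\ forall s, s \in S -> s != fset0 /\ affinely_independent s,
      forall s t, s \in S -> t != fset0 -> (t `<=` s)%fset -> t \in S &
      forall s t, s \in S -> t \in S ->
        convex_hull s `&` convex_hull t `<=` convex_hull (s `&` t)%fset].

Definition polyhedron S : set 'rV[R]_n :=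
  [set p | exists2 s, s \in S & convex_hull s p].

Definition subdivision S S' : Prop :=
  [/\ simplicial_complex S', polyhedron S' = polyhedron S &
      forall s', s' \in S' ->
        exists2 s, s \in S & convex_hull s' `<=` convex_hull s].

(* g gives the values of f at the vertices of s. *)
Definition linear_on S s (f : polyhedron S -> R) : Prop :=
  exists g : 'rV[R]_n -> R, forall a (p : polyhedron S), barycentric s a ->
    val p = \sum_(v <- s) a v *: v -> f p = \sum_(v <- s) a v * g v.

Definition piecewise_linear S (f : polyhedron S -> R) : Prop :=
  exists2 S', subdivision S S' & forall s, s \in S' -> linear_on s f.

End simplicial_complexes.

Section category_F0.
Variable R : realType.

Record F0 : Type := MkF0 {
  ambient : nat;
  cplx : {fset {fset 'rV[R]_ambient}};
  subcplx : {fset {fset 'rV[R]_ambient}};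
  fct : polyhedron cplx -> R;
  _ : simplicial_complex cplx;
  _ : simplicial_complex subcplx;
  _ : (subcplx `<=` cplx)%fset;
  _ : piecewise_linear fct }.

Definition space (X : F0) : topologicalType := polyhedron (cplx X).

Definition subspace0 (X : F0) : set (space X) :=
  [set p | polyhedron (subcplx X) (val p)].

Record F0_hom (X Y : F0) : Type := MkF0Hom {
  hom_map :> continuousType (space X) (space Y);
  _ : forall p, subspace0 p -> subspace0 (hom_map p);
  _ : forall p, fct (hom_map p) = fct p }.

(* A fiberwise homotopy is a morphism out of a triple on |X| x [0, 1]. As morphisms
   only see the underlying spaces, the triangulation of the product is left out. *)
Definition unit_interval : topologicalType := `[(0:R), 1]%classic.

Definition fiberwise_homotopic (X Y : F0) (phi psi : F0_hom X Y) : Prop :=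
  exists eta : continuousType (space X * unit_interval)%type (space Y),
    [/\ forall p t, subspace0 p -> subspace0 (eta (p, t)),
        forall p t, fct (eta (p, t)) = fct p,
        forall p (t : unit_interval), \val t = 0 -> eta (p, t) = phi p &
        forall p (t : unit_interval), \val t = 1 -> eta (p, t) = psi p].
End category_F0.

Section strip.
Variable R : realType.
Implicit Types (p q r : R * R) (n : int).

Definition strip : set (R * R) := [set p | - pi <= p.1 + p.2 <= pi].
Definition strip_le p q := (q.1 <= p.1) && (p.2 <= q.2).
Definition strip_boundary p := p.1 + p.2 = - pi \/ p.1 + p.2 = pi.
Definition interval_meets_boundary p q :=
  exists r, [/\ strip r, strip_le p r, strip_le r q & strip_boundary r].

Definition glide p : R * R := (- pi - p.2, pi - p.1).
Definition glide_inv p : R * R := (pi - p.2, - pi - p.1).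
Definition glide_pow n p : R * R :=
  match n with
  | Posz k => iter k glide p
  | Negz k => iter k.+1 glide_inv p
  end.

Definition fundamental_domain : set (R * R) :=
  [set p | strip p /\ 0 <= p.2 - p.1 < 2 * pi].

(* The n such that p is in T^-n(D), see [tileP]; T is [glide]. *)
Definition tile p : int := - Num.floor ((p.2 - p.1) / (2 * pi)).

Lemma glideK : cancel glide glide_inv.
Proof. by case=> x y; rewrite /glide /glide_inv /=; congr pair; ring. Qed.

Lemma glide_invK : cancel glide_inv glide.
Proof. by case=> x y; rewrite /glide /glide_inv /=; congr pair; ring. Qed.

Lemma glide_powS n p : glide_pow (n + 1) p = glide (glide_pow n p).
Proof.
case: n => [k|[|k]]; first by rewrite /= addn1.
  by rewrite /= glide_invK.
have -> : (Negz k.+1 + 1 = Negz k)%R by rewrite !NegzE; lia.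
by rewrite /= glide_invK.
Qed.

Lemma glide_pow_ind (P : R * R -> R * R -> int -> Prop) p q :
  P p q 0 -> (forall n p' q', P p' q' n -> P (glide p') (glide q') (n + 1)) ->
  (forall n p' q', P p' q' n -> P (glide_inv p') (glide_inv q') (n - 1)) ->
  forall n, P (glide_pow n p) (glide_pow n q) n.
Proof.
move=> P0 PS PN; case=> k.
  elim: k => [//|k IH]; rewrite -addn1 PoszD !glide_powS; exact: PS.
elim: k => [|k IH]; first exact: (PN 0).
have -> : (Negz k.+1 = Negz k - 1)%R by rewrite !NegzE; lia.
rewrite (_ : (Negz k - 1)%R = Negz k.+1); last by rewrite !NegzE; lia.
rewrite [X in P X _ _]/= [X in P _ X _]/=.
rewrite (_ : Negz k.+1 = (Negz k - 1)%R); last by rewrite !NegzE; lia.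
exact: PN.
Qed.

Lemma width_glide_pow n p :
  (glide_pow n p).2 - (glide_pow n p).1 = p.2 - p.1 + n%:~R * (2 * pi).
Proof.
apply: (@glide_pow_ind
  (fun p' _ n => p'.2 - p'.1 = p.2 - p.1 + n%:~R * (2 * pi)) p p) => /=.
- by rewrite mul0r addr0.
- move=> {}n p' _ h; rewrite intrD; move: h; set w := n%:~R * _ => h.
  rewrite mulrDl -/w; lra.
- move=> {}n p' _ h; rewrite intrB; move: h; set w := n%:~R * _ => h.
  rewrite mulrBl -/w; lra.
Qed.

Lemma strip_glide_pow n p : strip (glide_pow n p) <-> strip p.
Proof.
apply: (@glide_pow_ind (fun p' _ _ => strip p' <-> strip p) p p) => //;
  move=> _ p' _ <-; rewrite /strip /=;
  by split=> /andP[? ?]; apply/andP; split; lra.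
Qed.

Lemma strip_le_glide_pow n p q :
  strip_le (glide_pow n p) (glide_pow n q) <-> strip_le p q.
Proof.
apply: (@glide_pow_ind (fun p' q' _ => strip_le p' q' <-> strip_le p q) p q) => //;
  move=> _ p' q' <-; rewrite /strip_le /=;
  by split=> /andP[? ?]; apply/andP; split; lra.
Qed.

Lemma glide_pow_surj n p : exists q, glide_pow n q = p.
Proof.
have can k (f g : R * R -> R * R) : cancel g f -> cancel (iter k g) (iter k f).
  by move=> gK; elim: k => // k IH x; rewrite iterSr iterS gK.
case: n => k; [exists (iter k glide_inv p)|exists (iter k.+1 glide p)].
  exact: (can _ _ _ glide_invK).
exact: (can _ _ _ glideK).
Qed.

Definition separated p q :=
  [/\ p.1 + q.2 < pi, - pi < p.1 + q.2, q.1 + p.2 < pi & - pi < q.1 + p.2].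

Lemma separated_glide_pow n p q :
  separated (glide_pow n p) (glide_pow n q) <-> separated p q.
Proof.
apply: (@glide_pow_ind (fun p' q' _ => separated p' q' <-> separated p q) p q) => //;
  move=> _ p' q' <-; by split=> -[] /= *; split => /=; lra.
Qed.

Lemma separatedP p q : strip p -> strip q -> strip_le p q ->
  ~ interval_meets_boundary p q <-> separated p q.
Proof.
rewrite /strip /= => /andP[p1 p2] /andP[q1 q2] /andP[h1 h2].
have pi0 := pi_ge0 R; split=> [nm|[s1 s2 s3 s4] [r [rM /andP[r1 r2] /andP[r3 r4] [re|re]]]];
  [|lra|lra].
split; rewrite ltNge; apply/negP => s; apply: nm.
- exists (p.1, pi - p.1); split=> /=.
  + by rewrite /strip /=; apply/andP; split; lra.
  + by rewrite /strip_le /=; apply/andP; split; lra.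
  + by rewrite /strip_le /=; apply/andP; split; lra.
  + by right => /=; ring.
- exists p; split=> /=.
  + by rewrite /strip /=; apply/andP; split; lra.
  + by rewrite /strip_le /=; apply/andP; split; lra.
  + by rewrite /strip_le /=; apply/andP; split; lra.
  + by left; lra.
- exists p; split=> /=.
  + by rewrite /strip /=; apply/andP; split; lra.
  + by rewrite /strip_le /=; apply/andP; split; lra.
  + by rewrite /strip_le /=; apply/andP; split; lra.
  + by right; lra.
- exists (- pi - p.2, p.2); split=> /=.
  + by rewrite /strip /=; apply/andP; split; lra.
  + by rewrite /strip_le /=; apply/andP; split; lra.
  + by rewrite /strip_le /=; apply/andP; split; lra.
  + by left => /=; ring.
Qed.

Lemma tileP n p : tile p = n <-> 0 <= (glide_pow n p).2 - (glide_pow n p).1 < 2 * pi.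
Proof.
rewrite width_glide_pow /tile; have pi0 : 0 < 2 * pi :> R by have := pi_gt0 R; lra.
set w := _ / _; have -> : p.2 - p.1 = w * (2 * pi) by rewrite divfK ?gt_eqF.
rewrite -mulrDl pmulr_lge0 // gtr_pMl //.
have fP := floor_itv w; split.
  by move=> <-; rewrite mulrNz; move: fP => /andP[]; rewrite intrD => *; lra.
move=> /andP[h1 h2]; apply/eqP; rewrite eqr_oppLR; apply/eqP/floor_def.
by rewrite intrD mulrNz; apply/andP; split; lra.
Qed.

Lemma tile_glide_pow p : strip p -> fundamental_domain (glide_pow (tile p) p).
Proof. by move=> pM; split; [exact/strip_glide_pow|exact/tileP]. Qed.

Lemma tile_le p q : strip_le p q -> (tile q <= tile p)%R.
Proof.
move=> /andP[h1 h2]; rewrite lerN2; apply: le_floor; rewrite ler_pM2r; first lra.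
by rewrite invr_gt0; have := pi_gt0 R; lra.
Qed.

Lemma separated_tile p q : strip_le p q -> separated p q -> tile p != tile q ->
  tile p = (tile q + 1)%R.
Proof.
move=> pq spq ne; have le := tile_le pq.
apply/tileP.
have [/= s1 s2 s3 s4] := (separated_glide_pow (tile q) p q).2 spq.
have /andP[/= h1 h2] := (strip_le_glide_pow (tile q) p q).2 pq.
have /andP[w1 w2] := (tileP (tile q) q).1 erefl.
have : ~ (0 <= (glide_pow (tile q) p).2 - (glide_pow (tile q) p).1 < 2 * pi).
  by move/tileP/eqP; exact/negP.
rewrite glide_powS /= => h.
apply/andP; split; first lra.
rewrite ltNge; apply/negP => h'; apply: h; apply/andP; split; lra.
Qed.

End strip.

Section relative_interlevel_set_homology.
Variables (R : realType) (K : fieldType).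
Implicit Types (X Y : F0 R) (p q : R * R).

Definition earctan (t : \bar R) : R :=
  match t with r%:E => atan r | +oo%E => pi / 2 | -oo%E => - (pi / 2) end.

Definition level_I p : set (\bar R) := [set t | p.1 <= earctan t <= p.2].
Definition level_C p : set (\bar R) :=
  [set t | earctan t <= - pi - p.1 \/ pi - p.2 <= earctan t].

Definition interlevel X p : set (space X) * set (space X) :=
  ([set x | level_I p (fct x)%:E],
   [set x | (subspace0 x /\ level_I p (fct x)%:E) \/ level_C p (fct x)%:E]).

Definition to_domain p := glide_pow (tile p) p.

Definition h_obj X p : lmodType K :=
  homology R K (tile p) (interlevel X (to_domain p)).

Definition crosses p q : Prop :=
  [/\ strip p, strip q, strip_le p q, tile p != tile q &
      ~ interval_meets_boundary p q].

Definition h_zigzag X p q : h_obj X p -> h_obj X q -> Prop :=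
  let w := to_domain p in let v := to_domain q in
  @mv_zigzag R K (space X) (tile p) (tile q) (interlevel X w)
    (interlevel X (w.1, v.2)) (interlevel X (v.1, w.2)) (interlevel X v).

(* [mv_exact] is the part of the relative Mayer-Vietoris theorem that makes the
   connecting homomorphisms well defined: all pairs in it are pairs of subcomplexes
   of a common subdivision of X, so it always holds. It is not proved here; it is
   tested in [connecting] so that linearity, naturality and functoriality can be
   proved without it. The sign convention is fixed by the order of the two pieces
   (w.1, v.2) and (v.1, w.2) in [h_zigzag]. *)
Definition mv_exact : Prop := forall X p q, crosses p q ->
  forall x : h_obj X p, exists! y : h_obj X q, h_zigzag x y.

Definition connecting X p q (x : h_obj X p) : h_obj X q :=
  if `[< mv_exact >] then xget 0 (h_zigzag x : set (h_obj X q)) else 0.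

(* When the two tiles agree, the map is induced by inclusion. *)
Definition h_arr X p q (x : h_obj X p) : h_obj X q :=
  if tile p == tile q then hmap id x
  else if `[< interval_meets_boundary p q >] then 0
  else connecting q x.

Lemma interlevel_mono X p q : strip_le p q ->
  sub_pair (interlevel X p) (interlevel X q).
Proof.
move=> /andP[h1 h2].
have hI t : level_I p t -> level_I q t.
  by rewrite /level_I /= => /andP[? ?]; apply/andP; split; lra.
have hC t : level_C p t -> level_C q t.
  by rewrite /level_C /= => -[?|?]; [left|right]; lra.
by split=> x /=; [exact: hI|case=> [[? /hI ?]|/hC ?]; [left|right]].
Qed.

Lemma connecting_zigzag X p q (x : h_obj X p) (y : h_obj X q) :
  mv_exact -> crosses p q -> h_zigzag x y <-> connecting q x = y.
Proof.
move=> ex pq; rewrite /connecting asboolT //.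
have [y0 [y0P y0u]] := ex X p q pq x.
have gP : h_zigzag x (xget 0 (h_zigzag x : set (h_obj X q))).
  by apply: (@xgetPex _ 0 (h_zigzag x : set (h_obj X q))); exists y0.
split=> [yP|<- //]; by rewrite -(y0u _ gP) -(y0u _ yP).
Qed.

Lemma crosses_coords p q : crosses p q ->
  let w := to_domain p in let v := to_domain q in
  [/\ w.1 < v.1, v.2 < w.2, v.1 + w.2 <= pi, - pi <= w.1 + v.2
    & tile p = (tile q + 1)%R].
Proof.
move=> [pM qM pq ne /(separatedP pM qM pq) s].
have tp := separated_tile pq s ne.
rewrite /= /to_domain tp glide_powS.
have [/= *] := (separated_glide_pow (tile q) p q).2 s.
have /andP[/= *] := (strip_le_glide_pow (tile q) p q).2 pq.
by split=> //=; lra.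
Qed.

Lemma to_domainP p : strip p -> fundamental_domain (to_domain p).
Proof. exact: tile_glide_pow. Qed.

Lemma strip_le_to_domain p q : tile p = tile q -> strip_le p q ->
  strip_le (to_domain p) (to_domain q).
Proof. move=> e; rewrite /to_domain e => ?; exact/strip_le_glide_pow. Qed.

Lemma interlevel_to_domain X p q : tile p = tile q -> strip_le p q ->
  sub_pair (interlevel X (to_domain p)) (interlevel X (to_domain q)).
Proof. by move=> *; apply/interlevel_mono/strip_le_to_domain. Qed.

Lemma h_arr_linear X p q : strip p -> strip q -> strip_le p q ->
  linear (@h_arr X p q).
Proof.
move=> pM qM pq; rewrite /h_arr => a x y.
case: eqP => [e|/eqP ne].
  exact/(incl_linear e)/interlevel_to_domain.
case: asboolP => [_|nm]; first by rewrite scaler0 addr0.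
have [ex|nex] := pselect mv_exact; last first.
  by rewrite /connecting asboolF // scaler0 addr0.
have c : crosses p q by split.
apply/(connecting_zigzag _ _ ex c)/mv_zigzag_linear.
  exact/(connecting_zigzag _ _ ex c).
exact/(connecting_zigzag _ _ ex c).
Qed.

Lemma h_arr_id X p (x : h_obj X p) : h_arr p x = x.
Proof. by rewrite /h_arr eqxx; exact: repK. Qed.

Lemma meets_coords p q : strip p -> strip q -> strip_le p q ->
  tile p = (tile q + 1)%R -> interval_meets_boundary p q ->
  (to_domain q).1 <= (to_domain p).1 \/ (to_domain p).2 <= (to_domain q).2.
Proof.
move=> pM qM pq tp.
have [h1 _|h1] := leP (to_domain q).1 (to_domain p).1; first by left.
have [h2 _|h2] := leP (to_domain p).2 (to_domain q).2; first by right.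
move=> m; exfalso; suff : ~ interval_meets_boundary p q by [].
apply/(separatedP pM qM pq)/(separated_glide_pow (tile q)).
have /andP[] := (strip_le_glide_pow (tile q) p q).2 pq.
have := (strip_glide_pow (tile q) p).2 pM; rewrite /strip /= => /andP[].
have := (strip_glide_pow (tile q) q).2 qM; rewrite /strip /= => /andP[].
move: h1 h2; rewrite /to_domain tp glide_powS /= => *.
by split; lra.
Qed.

Lemma connecting_incl_l X p p' q (x : h_obj X p) : mv_exact ->
  crosses p q -> crosses p' q -> tile p = tile p' -> strip_le p p' ->
  connecting q (hmap id x : h_obj X p') = connecting q x.
Proof.
move=> ex c c' e pp'.
apply/(connecting_zigzag _ _ ex c').
have {1}<- : hmap id (connecting q x) = connecting q x by exact: incl_id.
have /andP[h1 h2] := strip_le_to_domain e pp'.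
apply: mv_zigzag_mono ((connecting_zigzag x _ ex c).2 erefl) => //.
- exact: interlevel_to_domain.
- by apply: interlevel_mono; apply/andP; split=> /=.
- by apply: interlevel_mono; apply/andP; split=> /=.
- by split.
Qed.

Lemma connecting_incl_r X p q q' (x : h_obj X p) : mv_exact ->
  crosses p q -> crosses p q' -> tile q = tile q' -> strip_le q q' ->
  connecting q' x = hmap id (connecting q x).
Proof.
move=> ex c c' e qq'.
apply/(connecting_zigzag _ _ ex c').
have {1}<- : hmap id x = x by exact: incl_id.
have /andP[h1 h2] := strip_le_to_domain e qq'.
apply: mv_zigzag_mono ((connecting_zigzag x _ ex c).2 erefl) => //.
- by split.
- by apply: interlevel_mono; apply/andP; split=> /=.
- by apply: interlevel_mono; apply/andP; split=> /=.
- exact: interlevel_to_domain.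
Qed.

Lemma connecting_linear X p q : crosses p q -> linear (@connecting X p q).
Proof.
move=> c a x y; have [pM qM pq ne nm] := c.
have := h_arr_linear (X := X) pM qM pq a x y.
by rewrite /h_arr (negbTE ne) asboolF.
Qed.

Lemma connecting0 X p q : crosses p q -> connecting q (0 : h_obj X p) = 0.
Proof.
move=> /(@connecting_linear X)/(_ (-1) 0 0).
by rewrite !scaleN1r oppr0 addr0 addNr.
Qed.

Lemma connecting_incl_l0 X p q r (x : h_obj X p) : mv_exact ->
  strip p -> strip_le p q -> tile p = tile q -> crosses q r ->
  interval_meets_boundary p r ->
  connecting r (hmap id x : h_obj X q) = 0.
Proof.
move=> ex pM pq e c m; have [qM rM qr _ _] := c.
have /andP[p1 p2] := pq; have /andP[q1 q2] := qr.
have pr : strip_le p r by apply/andP; split; lra.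
have [/= c1 c2 c3 c4 tq] := crosses_coords c.
have mc := meets_coords pM rM pr (etrans e tq) m.
have /andP[h1 h2] := strip_le_to_domain e pq.
apply/(connecting_zigzag _ _ ex c).
have sub := interlevel_to_domain X e pq.
rewrite -[x]repK incl_class ?rep_in //.
have xZ : rep x \in rel_cycles (tile q) (interlevel X (to_domain p)).
  by rewrite -e; exact: rep_in.
have [P2s|P1s] : sub_pair (interlevel X (to_domain p))
      (interlevel X ((to_domain r).1, (to_domain q).2)) \/
    sub_pair (interlevel X (to_domain p))
      (interlevel X ((to_domain q).1, (to_domain r).2)).
- by case: mc => mc; [left|right]; apply: interlevel_mono; apply/andP.
- exact: (@mv_zigzag_right R K (space X) _ _ _ _ _ _ _ _ tq sub P2s xZ).
- exact: (@mv_zigzag_left R K (space X) _ _ _ _ _ _ _ _ tq sub P1s xZ).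
Qed.

Lemma connecting_incl_r0 X p q r (x : h_obj X p) : mv_exact ->
  strip r -> strip_le q r -> tile q = tile r -> crosses p q ->
  interval_meets_boundary p r ->
  hmap id (connecting q x) = 0 :> h_obj X r.
Proof.
move=> ex rM qr e c m; have [pM qM pq _ _] := c.
have /andP[p1 p2] := pq; have /andP[q1 q2] := qr.
have pr : strip_le p r by apply/andP; split; lra.
have [/= c1 c2 c3 c4 tp] := crosses_coords c.
have mc := meets_coords pM rM pr (etrans tp (congr1 (fun n => n + 1) e)) m.
have /andP[h1 h2] := strip_le_to_domain e qr.
apply: (mv_zigzag_incl0 tp e _ _ ((connecting_zigzag x _ ex c).2 erefl)).
  exact: interlevel_to_domain.
by case: mc => mc; [left|right]; apply: interlevel_mono; apply/andP; split=> /=.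
Qed.

Lemma connecting_connecting X p q r (x : h_obj X p) : mv_exact ->
  crosses p q -> crosses q r -> connecting r (connecting q x) = 0.
Proof.
move=> ex c c'.
have [pM qM pq _ _] := c; have [_ rM qr _ _] := c'.
have [/= c1 c2 c3 c4 tp] := crosses_coords c.
have [/= d1 d2 d3 d4 tq] := crosses_coords c'.
have [Um /andP[Uw Uw']] := to_domainP pM.
have [Vm /andP[Vw Vw']] := to_domainP qM.
have [Wm /andP[Ww Ww']] := to_domainP rM.
move: Um Vm Wm; rewrite /strip /= => /andP[Um Um'] /andP[Vm Vm'] /andP[Wm Wm'].
(* a point in the tile of q through which the composite factors *)
suff [s [sM ts qs sr [PI0 nm]]] : exists s, [/\ strip s, tile s = tile q,
    strip_le q s, strip_le s r &
    (sub_pair (interlevel X ((to_domain p).1, (to_domain q).2))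
              (interlevel X (to_domain s)) \/
     sub_pair (interlevel X ((to_domain q).1, (to_domain p).2))
              (interlevel X (to_domain s))) /\
    separated s r].
  have cs : crosses s r.
    split=> //; last exact/separatedP.
    by rewrite ts tq -subr_eq0 addrAC subrr add0r.
  rewrite -(connecting_incl_l (connecting q x) ex c' cs) //.
  rewrite (mv_zigzag_incl0 tp _ _ PI0 ((connecting_zigzag x _ ex c).2 erefl)) //.
    exact: connecting0.
  exact: interlevel_to_domain.
(* such a point is given by its image u in the fundamental domain *)
have key u1 u2 : (to_domain p).1 <= u1 <= (to_domain q).1 ->
    (to_domain q).2 <= u2 <= (to_domain p).2 ->
    - pi <= u1 + u2 <= pi -> - pi <= u1 + (to_domain r).2 ->
    (to_domain r).1 + u2 <= pi ->
    exists s, [/\ strip s, tile s = tile q, strip_le q s, strip_le s r &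
      to_domain s = (u1, u2) /\ separated s r].
  move=> /andP[a1 a2] /andP[b1 b2] uM e1 e2.
  have [s sE] := glide_pow_surj (tile q) (u1, u2).
  have ts : tile s = tile q by apply/tileP; rewrite sE /=; apply/andP; split; lra.
  have : glide (glide_pow (tile r) s) = (u1, u2) by rewrite -glide_powS -tq.
  case sr : (glide_pow (tile r) s) => [y1 y2]; rewrite /glide /= => -[e3 e4].
  exists s; split=> //.
  - by apply/(strip_glide_pow (tile q)); rewrite sE.
  - apply/(strip_le_glide_pow (tile q)); rewrite sE -/(to_domain q).
    by apply/andP; split.
  - apply/(strip_le_glide_pow (tile r)); rewrite sr -/(to_domain r).
    by apply/andP; split=> /=; lra.
  - split; first by rewrite /to_domain ts.
    apply/(separated_glide_pow (tile r)); rewrite sr -/(to_domain r).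
    by split=> /=; lra.
have [e|e] := leP (- pi) ((to_domain p).1 + (to_domain r).2).
  have [s [s1 s2 s3 s4 [s5 s6]]] : exists s, [/\ strip s, tile s = tile q,
      strip_le q s, strip_le s r &
      to_domain s = ((to_domain p).1, (to_domain q).2) /\ separated s r].
    by apply: key; first [apply/andP; split; lra | lra].
  by exists s; split=> //; split=> //; left; rewrite s5; split.
have [s [s1 s2 s3 s4 [s5 s6]]] : exists s, [/\ strip s, tile s = tile q,
    strip_le q s, strip_le s r &
    to_domain s = ((to_domain q).1, (to_domain p).2) /\ separated s r].
  by apply: key; first [apply/andP; split; lra | lra].
by exists s; split=> //; split=> //; right; rewrite s5; split.
Qed.

Lemma h_arr_comp X p q r (x : h_obj X p) : strip p -> strip q -> strip r ->
  strip_le p q -> strip_le q r -> h_arr r (h_arr q x) = h_arr r x.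
Proof.
move=> pM qM rM pq qr.
have pr : strip_le p r.
  by move: pq qr => /andP[? ?] /andP[? ?]; apply/andP; split; lra.
have meets_l : interval_meets_boundary q r -> interval_meets_boundary p r.
  move=> [s [sM /andP[h1 h2] h3 h4]]; exists s; split=> //.
  by move: pq => /andP[? ?]; apply/andP; split; lra.
have meets_r : interval_meets_boundary p q -> interval_meets_boundary p r.
  move=> [s [sM h3 /andP[h1 h2] h4]]; exists s; split=> //.
  by move: qr => /andP[? ?]; apply/andP; split; lra.
have pq_le := tile_le pq; have qr_le := tile_le qr.
rewrite /h_arr; have [epq|npq] := eqVneq (tile p) (tile q).
- have [eqr|nqr] := eqVneq (tile q) (tile r).
    have -> : tile p == tile r by rewrite epq eqr.
    by apply: incl_incl => //; exact: interlevel_to_domain.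
  have npr : tile p != tile r by rewrite epq.
  rewrite (negbTE npr).
  have [mqr|nmqr] := asboolP (interval_meets_boundary q r).
    by rewrite asboolT //; exact: meets_l.
  have cqr : crosses q r by split.
  have [ex|nex] := pselect mv_exact; last first.
    by rewrite /connecting asboolF // if_same.
  have [mpr|nmpr] := asboolP (interval_meets_boundary p r).
    exact: connecting_incl_l0.
  by apply: connecting_incl_l.
- have npr : tile p != tile r.
    by apply: contra_neq npq => e; apply/eqP; rewrite eq_le pq_le e qr_le.
  rewrite (negbTE npr); have [eqr|nqr] := eqVneq (tile q) (tile r).
    have incl0 : hmap id (0 : h_obj X q) = 0 :> h_obj X r.
      have l := incl_linear (R := R) (K := K) eqr (interlevel_to_domain X eqr qr).
      by have := l (-1) 0 0; rewrite !scaleN1r oppr0 addr0 addNr.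
    have [mpq|nmpq] := asboolP (interval_meets_boundary p q).
      by rewrite asboolT //; exact: meets_r.
    have cpq : crosses p q by split.
    have [ex|nex] := pselect mv_exact; last first.
      by rewrite /connecting asboolF // if_same incl0.
    have [mpr|nmpr] := asboolP (interval_meets_boundary p r).
      exact: connecting_incl_r0.
    by apply/esym/connecting_incl_r.
  have mpr : interval_meets_boundary p r.
    apply: contrapT => nm.
    have tpr := separated_tile pr ((separatedP pM rM pr).1 nm) npr.
    move: npq nqr pq_le qr_le; rewrite tpr; lia.
  rewrite [in RHS]asboolT //.
  have [mqr|nmqr] := asboolP (interval_meets_boundary q r); first by [].
  have cqr : crosses q r by split.
  have [mpq|nmpq] := asboolP (interval_meets_boundary p q).
    exact: connecting0.
  have [ex|nex] := pselect mv_exact; first exact: connecting_connecting.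
  by rewrite /connecting asboolF.
Qed.

Lemma interlevel_hom X Y (phi : F0_hom X Y) p :
  (forall x, (interlevel X p).1 x -> (interlevel Y p).1 (phi x)) /\
  (forall x, (interlevel X p).2 x -> (interlevel Y p).2 (phi x)).
Proof.
case: phi => f fA ff; split=> x /=; rewrite ff // => -[[xA xI]|xC]; last by right.
by left; split=> //; exact: fA.
Qed.

Definition h_comp X Y (phi : F0_hom X Y) p : h_obj X p -> h_obj Y p :=
  hmap (push phi).

Lemma h_comp_linear X Y (phi : F0_hom X Y) p : linear (h_comp phi (p := p)).
Proof. by have [? ?] := interlevel_hom phi (to_domain p); exact: hmap_push_linear. Qed.

Lemma h_comp_natural X Y (phi : F0_hom X Y) p q (x : h_obj X p) :
  strip p -> strip q -> strip_le p q ->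
  h_comp phi (h_arr q x) = h_arr q (h_comp phi x).
Proof.
move=> pM qM pq.
have phi0 r : h_comp phi (0 : h_obj X r) = 0.
  have := @h_comp_linear _ _ phi r (-1) 0 0.
  by rewrite !scaleN1r oppr0 addr0 addNr.
have [fp1 fp2] := interlevel_hom phi (to_domain p).
have [fq1 fq2] := interlevel_hom phi (to_domain q).
rewrite /h_arr; case: eqP => [e|/eqP ne].
  rewrite -[x]repK /h_comp incl_class ?rep_in //; last exact: interlevel_to_domain.
  rewrite !hmap_push_class ?rep_in //; last first.
    exact/(rel_cycles_mono e (interlevel_to_domain X e pq))/rep_in.
  rewrite incl_class //; first exact: interlevel_to_domain.
  exact: (rel_cycles_push fp1 fp2 (rep_in x)).
case: asboolP => [_|nm]; first exact: phi0.
have c : crosses p q by split.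
have [ex|nex] := pselect mv_exact; last by rewrite /connecting asboolF.
have [f12 f12'] := interlevel_hom phi ((to_domain p).1, (to_domain q).2).
have [f21 f21'] := interlevel_hom phi ((to_domain q).1, (to_domain p).2).
apply/esym/(connecting_zigzag _ _ ex c).
by apply: mv_zigzag_push ((connecting_zigzag x _ ex c).2 erefl).
Qed.

End relative_interlevel_set_homology.

(* Functors from the poset to K-vector spaces, and natural transformations. That the
   values of [interlevel_homology] are finite-dimensional is a property of objects,
   which does not affect morphisms, and is not recorded. *)
Section functors_on_strip.
Variables (R : realType) (K : fieldType).

Record strip_module : Type := MkStripModule {
  sm_obj :> @strip R -> lmodType K;
  sm_arr : forall u v : @strip R, strip_le (\val u) (\val v) ->
    sm_obj u -> sm_obj v;
  _ : forall u v (uv : strip_le (\val u) (\val v)), linear (sm_arr uv);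
  _ : forall u (uu : strip_le (\val u) (\val u)) x, sm_arr uu x = x;
  _ : forall u v w (uv : strip_le (\val u) (\val v))
        (vw : strip_le (\val v) (\val w)) (uw : strip_le (\val u) (\val w)) x,
        sm_arr vw (sm_arr uv x) = sm_arr uw x }.

Record strip_module_hom (G H : strip_module) : Type := MkStripModuleHom {
  component :> forall u : @strip R, G u -> H u;
  _ : forall u, linear (@component u);
  _ : forall u v (uv : strip_le (\val u) (\val v)) (x : G u),
        component (sm_arr uv x) = sm_arr uv (component x) }.

Definition interlevel_homology (X : F0 R) : strip_module := @MkStripModule
    (fun u => h_obj K X (\val u))
  (fun u v _ => @h_arr R K X (\val u) (\val v))
  (fun u v uv => h_arr_linear (set_mem (valP u)) (set_mem (valP v)) uv)
  (fun u _ x => h_arr_id x)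
  (fun u v w uv vw _ x => h_arr_comp x (set_mem (valP u)) (set_mem (valP v))
     (set_mem (valP w)) uv vw).

Definition interlevel_homology_map (X Y : F0 R) (phi : F0_hom X Y) :
    strip_module_hom (interlevel_homology X) (interlevel_homology Y) :=
  @MkStripModuleHom (interlevel_homology X) (interlevel_homology Y)
  (fun u => @h_comp R K X Y phi (\val u))
  (fun u => @h_comp_linear R K X Y phi (\val u))
  (fun u v uv x => h_comp_natural phi x (set_mem (valP u)) (set_mem (valP v)) uv).

End functors_on_strip.

(* Main.v *)
From HB Require Import structures.
Require Import Defs.
From mathcomp Require Import all_boot all_order all_algebra.
From mathcomp Require Import all_classical all_reals all_analysis.
From mathcomp Require Import zify.
From mathcomp.multinomials Require Import freeg.

Set Implicit Arguments.
Unset Strict Implicit.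
Unset Printing Implicit Defensive.

Import Order.TTheory GRing.Theory Num.Theory.
Import numFieldNormedType.Exports.

Local Open Scope classical_set_scope.
Local Open Scope ring_scope.

(** The maps induced on the pairs [F(u)] by two fiberwise homotopic morphisms are
    homotopic as maps of pairs: a homotopy over the reals that preserves the
    subspaces A and B carries [F(u) x [0, 1]], for the source triple, into [F(u)]
    for the target, since membership in [F(u)] only depends on the level and on
    lying in the distinguished subspace. The statement is therefore an instance of
    the homotopy invariance of relative singular homology,
    [hmap_push_homotopic]. A natural transformation is determined by its
    components ([strip_module_hom_ext]), so the connecting homomorphisms do not
    enter the argument.

    Homotopy invariance is proved with the prism operator D, a natural map that
    raises the degree of chains by one, and satisfies

      boundary (D c) = push psi c - push phi c - D (boundary c)

    ([boundary_homotopy_operator]). If c is a cycle relative to a subspace, D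
    (boundary c) lies in the corresponding subspace of the target, so the two
    pushforwards of c differ by a relative boundary.

    D sends an n-simplex s to the alternating sum of the simplices that
    triangulate the image of the prism on s. Each of these is [prism a p s]: the
    vertex j of its domain is mapped to the vertex [a j] of the n-simplex, at the
    top of the prism if [p j] and at the bottom otherwise. In this encoding, faces
    of prism simplices and prism simplices on faces are both computed by composing
    with the coface maps of vertices ([face_prism], [prism_face]), so that the
    simplicial identities are equations between functions on natural numbers,
    and what is left is the cancellation of a double sum
    ([prism_cancellation]). *)

(** * Cancellation in the boundary of a prism *)

(** The sum expanded on the left is the boundary of a triangulated prism, where
    [B i k] is the face i of the top-dimensional simplex k. The faces with i = k
    and i = k + 1 are shared by consecutive simplices and telescope to the top and
    the bottom [G 0], [G n.+1] of the prism; the other ones triangulate the prisms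
    on the faces of the base, [A i k] being the simplex k over the face i. *)
Lemma prism_cancellation (K : pzRingType) (V : lmodType K) (n : nat)
    (A B : nat -> nat -> V) (G : nat -> V) :
  (forall i k, (i <= k < n)%N -> B i k.+1 = A i k) ->
  (forall k, (k <= n)%N -> B k k = G k) ->
  (forall k, (k <= n)%N -> B k.+1 k = G k.+1) ->
  (forall i k, (k < i <= n)%N -> B i.+1 k = A i k) ->
  \sum_(k < n.+1) \sum_(i < n.+2) (-1) ^+ (k + i) *: B i k =
  G 0 - G n.+1 - \sum_(i < n.+1) \sum_(k < n) (-1) ^+ (i + k) *: A i k.
Proof.
move=> lower diag diag' upper.
pose a k i := (-1) ^+ (k + i) *: A i k.
pose low k := \sum_(0 <= i < k) (-1) ^+ (k + i) *: B i k.
have column k : (k < n.+1)%N ->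
    \sum_(i < n.+2) (-1) ^+ (k + i) *: B i k =
    low k - (G k.+1 - G k) - \sum_(k.+1 <= i < n.+1) a k i.
  move=> kn; rewrite -(big_mkord xpredT (fun i => (-1) ^+ (k + i) *: B i k)).
  rewrite (@big_cat_nat _ _ _ k) //=; last lia.
  rewrite [X in _ + X = _]big_ltn; last lia.
  rewrite [X in _ + (_ + X)]big_ltn; last lia.
  rewrite diag ?diag' // -addrA; congr (_ + _).
  rewrite addnn addnS addnn exprS -signr_odd odd_double expr0 mulr1 scale1r.
  rewrite scaleN1r addrA opprB; congr (_ + _).
  rewrite big_add1 -sumrN; apply: eq_big_nat => i ki.
  by rewrite upper ?addnS ?exprS ?mulN1r ?scaleNr //; lia.
transitivity (\sum_(0 <= k < n.+1)
    (low k - (G k.+1 - G k) - \sum_(k.+1 <= i < n.+1) a k i)).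
  by rewrite big_mkord; apply: eq_bigr => k _; exact: column.
rewrite !big_split /= !sumrN telescope_sumr // opprB -addrA addrCA; congr (_ + _).
have -> : \sum_(0 <= k < n.+1) low k = \sum_(0 <= k < n) low k.+1.
  by rewrite big_nat_recl // [low 0]big_geq // add0r.
rewrite big_nat_recr //= [X in _ - (_ + X)]big_geq // addr0.
have -> : \sum_(i < n.+1) \sum_(k < n) (-1) ^+ (i + k) *: A i k =
    \sum_(0 <= k < n) \sum_(i < n.+1) (-1) ^+ (i + k) *: A i k.
  by rewrite exchange_big big_mkord.
rewrite -!sumrN -big_split.
apply: eq_big_nat => k kn /=.
rewrite -(big_mkord xpredT (fun i => (-1) ^+ (i + k) *: A i k)).
rewrite [in RHS](@big_cat_nat _ _ _ k.+1) //=; last lia.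
rewrite opprD; congr (_ + _); last first.
  by congr (- _); apply: eq_bigr => i _; rewrite /a addnC.
rewrite -sumrN; apply: eq_big_nat => i ik.
by rewrite lower 1?addnC ?addnS ?exprS ?mulN1r ?scaleNr //; lia.
Qed.

(** * Simplicial maps between standard simplices *)

Section simplex_maps.
Variable R : realType.
Local Notation simplex m := (@std_simplex R m).

(** The affine extension of a map of vertices, in barycentric coordinates. *)
Definition vertex_row m n (a : 'I_m -> 'I_n) (x : 'rV[R]_m) : 'rV[R]_n :=
  \row_j \sum_(i | a i == j) x ord0 i.

Lemma vertex_row_simplex m n (a : 'I_m.+1 -> 'I_n.+1) x :
  std_simplex x -> std_simplex (vertex_row a x).
Proof.
move=> [x0 x1]; split=> [j|]; first by rewrite mxE sumr_ge0.
rewrite -x1 (partition_big a xpredT) //=.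
by apply: eq_bigr => j _; rewrite mxE.
Qed.

Definition vertex_map m n (a : 'I_m.+1 -> 'I_n.+1) (x : simplex m) :
    simplex n :=
  exist _ (vertex_row a (val x)) (mem_set (vertex_row_simplex a (set_mem (valP x)))).

Lemma sum_coord_continuous m (p : pred 'I_m.+1) :
  continuous (fun x : simplex m => \sum_(i | p i) val x ord0 i).
Proof.
move=> x; apply: (cvg_big _ (nbhs_filter x)) => [|i _]; first exact: add_continuous.
apply: (@continuous_comp _ _ _ (set_val : simplex m -> 'rV[R]_m.+1)
  (fun y : 'rV[R]_m.+1 => y ord0 i)).
  exact: initial_continuous.
exact: coord_continuous.
Qed.

Lemma vertex_map_continuous m n (a : 'I_m.+1 -> 'I_n.+1) :
  continuous (@vertex_map m n a).
Proof.
apply: continuous_comp_initial => x A [P nP PA].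
apply: (@filterS _ (nbhs x) _
  (fun y => forall j : 'I_n.+1, P ord0 j (vertex_row a (val y) ord0 j))).
  by move=> y hy; apply: PA => b c; rewrite ord1; exact: hy.
apply: (@filter_forall _ _
  (fun j y => P ord0 j (vertex_row a (val y) ord0 j)) (nbhs x)) => j.
have := nP ord0 j; rewrite /= mxE => nPj.
have h : nbhs x (fun y => P ord0 j (\sum_(i | a i == j) val y ord0 i)).
  exact: sum_coord_continuous nPj.
by apply: filterS h => y; rewrite mxE.
Qed.
HB.instance Definition _ m n a := @isContinuous.Build
  (simplex m) (simplex n) (@vertex_map m n a)
  (@vertex_map_continuous m n a).

Lemma sum_coord_unit m (p : pred 'I_m.+1) (x : simplex m) :
  `[(0 : R), 1]%classic (\sum_(i | p i) val x ord0 i).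
Proof.
have [x0 x1] := set_mem (valP x); rewrite /= in_itv /= sumr_ge0 //=.
by rewrite -x1 [leRHS](bigID p) /= lerDl sumr_ge0.
Qed.

(** The affine function that is 1 on the vertices in p and 0 on the others. *)
Definition height m (p : pred 'I_m.+1) (x : simplex m) : unit_interval R :=
  exist _ (\sum_(i | p i) val x ord0 i) (mem_set (sum_coord_unit p x)).

Lemma height_continuous m (p : pred 'I_m.+1) : continuous (@height m p).
Proof. by apply: continuous_comp_initial; exact: sum_coord_continuous. Qed.

Lemma coface_vertex_map n (i : 'I_n.+2) :
  @coface R n i =1 vertex_map (fintype.lift i).
Proof.
move=> x; apply: val_inj; apply/rowP => j; rewrite !mxE.
case: unliftP => [k ->|->].
  by rewrite (big_pred1 k) // => l /=; rewrite (inj_eq lift_inj).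
by rewrite big1 // => k /eqP e; have := neq_lift i k; rewrite e eqxx.
Qed.

Lemma vertex_map_comp l m n (a : 'I_m.+1 -> 'I_n.+1) (b : 'I_l.+1 -> 'I_m.+1) x :
  vertex_map a (vertex_map b x) = vertex_map (a \o b) x.
Proof.
apply: val_inj; apply/rowP => j; rewrite !mxE.
rewrite [RHS](partition_big b (fun i => a i == j)) //=.
apply: eq_bigr => i /eqP ij; rewrite mxE; apply: eq_bigl => k.
by case: (eqVneq (b k) i) => [->|_]; rewrite ?ij ?eqxx ?andbF.
Qed.

Lemma vertex_map_id n (a : 'I_n.+1 -> 'I_n.+1) x : a =1 id -> vertex_map a x = x.
Proof.
move=> aE; apply: val_inj; apply/rowP => j; rewrite !mxE (big_pred1 j) // => i.
by rewrite aE.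
Qed.

Lemma height_vertex_map m n (a : 'I_m.+1 -> 'I_n.+1) (p : pred 'I_n.+1) x :
  height p (vertex_map a x) = height (p \o a) x.
Proof.
apply: val_inj; rewrite /= [RHS](partition_big a p) //=.
apply: eq_bigr => i pi; rewrite mxE; apply: eq_bigl => k.
by case: (eqVneq (a k) i) => [->|_]; rewrite ?pi ?andbF.
Qed.

End simplex_maps.

(** * The prism operator *)

Section linear_maps.
Variables (R : realType) (K : fieldType).

HB.instance Definition _ (T : topologicalType) :=
  GRing.isLinear.Build K (chain R K T) (chain R K T) *:%R (@boundary R K T)
    (@boundary_linear R K T).

HB.instance Definition _ (T T' : topologicalType) (f : continuousType T T') :=
  GRing.isLinear.Build K (chain R K T) (chain R K T') *:%R (push f) (push_linear f).

Lemma fglift1 (S : choiceType) (M : lmodType K) (f : S -> M) x :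
  fglift f << x >> = f x.
Proof. by rewrite liftU scale1r. Qed.

End linear_maps.

Section prism.
Variables (R : realType) (K : fieldType) (T T' : topologicalType).
Local Notation simplex m := (@std_simplex R m).
Variable eta : continuousType (T * unit_interval R)%type T'.

Definition prism_fun m n (a : 'I_m.+1 -> 'I_n.+1) (p : pred 'I_m.+1)
    (s : continuousType (simplex n) T) (x : simplex m) : T' :=
  eta (s (vertex_map a x), height p x).

Lemma prism_fun_continuous m n a p s : continuous (@prism_fun m n a p s).
Proof.
move=> x; apply: (@continuous_comp _ _ _
  (fun y => (s (vertex_map a y), height p y)) eta); last exact: cts_fun.
apply: (cvg_pair (FF := nbhs_filter x) (G := nbhs (s (vertex_map a x)))
  (H := nbhs (height p x))); last exact: height_continuous.
apply: (@continuous_comp _ _ _ (vertex_map a) s); first exact: cts_fun.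
exact: cts_fun.
Qed.
HB.instance Definition _ m n a p s := @isContinuous.Build
  (simplex m) T' (@prism_fun m n a p s) (@prism_fun_continuous m n a p s).

Definition prism m n a p s : continuousType (simplex m) T' := @prism_fun m n a p s.

Local Notation simplex_of T m s :=
  (existT (fun n => continuousType (@std_simplex R n) T) m s).

Definition elem_chain n (s : continuousType (simplex n) T') : chain R K T' :=
  << simplex_of T' n s >>.

Lemma eq_prism m n (a a' : 'I_m.+1 -> 'I_n.+1) (p p' : pred 'I_m.+1) s :
  a =1 a' -> p =1 p' -> prism a p s = prism a' p' s.
Proof. by move=> /funext -> /funext ->. Qed.

(** Both [face_prism] and [prism_face] hold since [coface i] is affine with
    vertex map [lift i]: it acts on the source of a prism simplex by
    precomposition, and on the base of the prism by postcomposition. *)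
Lemma face_prism m n (a : 'I_m.+2 -> 'I_n.+1) p s i :
  face i (prism a p s) = prism (a \o fintype.lift i) (p \o fintype.lift i) s.
Proof.
apply/continuousEP => x.
by rewrite /= /prism_fun coface_vertex_map vertex_map_comp height_vertex_map.
Qed.

Lemma prism_face m n (a : 'I_m.+1 -> 'I_n.+1) p
    (s : continuousType (simplex n.+1) T) i :
  prism a p (face i s) = prism (fintype.lift i \o a) p s.
Proof.
apply/continuousEP => x.
by rewrite /= /prism_fun /= coface_vertex_map vertex_map_comp.
Qed.

(** The simplex of index k has the vertices 0, ..., k at the bottom of the prism,
    followed by k, ..., n at its top: [unbump k], the k-th degeneracy, repeats k. *)
Definition prism_chain (s : singular_simplex R T) : chain R K T' :=
  \sum_(k < (tag s).+1) (-1) ^+ k *: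
    elem_chain (prism (fun j : 'I_(tag s).+2 => inord (unbump k j))
                      (fun j => k < j)%N (tagged s)).

Definition homotopy_operator : chain R K T -> chain R K T' := fglift prism_chain.

HB.instance Definition _ := GRing.isLinear.Build K (chain R K T) (chain R K T')
  *:%R homotopy_operator (fglift_linear prism_chain).

Lemma homotopy_operator_simplex_boundary n (s : continuousType (simplex n) T) :
  homotopy_operator (simplex_boundary K (simplex_of T n s)) =
  \sum_(i < n.+1) \sum_(k < n) (-1) ^+ (i + k) *:
    elem_chain (prism (fun j : 'I_n.+1 => inord (bump i (unbump k j)))
                      (fun j => k < j)%N s).
Proof.
case: n s => [|n] s; first by rewrite linear0 big1 // => i _; rewrite big_ord0.
rewrite linear_sum; apply: eq_bigr => i _; rewrite linearZ /=.
rewrite /homotopy_operator fglift1 /prism_chain /= scaler_sumr.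
apply: eq_bigr => k _; rewrite scalerA -exprD prism_face.
congr (_ *: elem_chain _); apply: eq_prism => // j; apply: val_inj.
have jn := ltn_ord j; have kn := ltn_ord k; have i_n := ltn_ord i.
have le : (unbump k j < n.+1)%N by rewrite /unbump; lia.
by rewrite /= !inordK // /bump; lia.
Qed.

Variables phi psi : continuousType T T'.
Hypothesis eta0 : forall x (t : unit_interval R), \val t = 0 -> eta (x, t) = phi x.
Hypothesis eta1 : forall x (t : unit_interval R), \val t = 1 -> eta (x, t) = psi x.

(** Instance of [prism_cancellation]. The vertex maps are written as functions on
    natural numbers, so that its four hypotheses, which are the identities between
    cofaces and degeneracies, are decided by linear arithmetic. *)
Lemma boundary_prism_chain (s : singular_simplex R T) :
  boundary (prism_chain s) =
  << simplex_push psi s >> - << simplex_push phi s >>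
  - homotopy_operator (simplex_boundary K s).
Proof.
case: s => n s; rewrite homotopy_operator_simplex_boundary.
pose cell (a : nat -> nat) (p : pred nat) : chain R K T' :=
  elem_chain (prism (fun j : 'I_n.+1 => inord (a j)) (fun j => p j) s).
have eq_cell a a' (p p' : pred nat) :
    (forall j, (j <= n)%N -> a j = a' j /\ p j = p' j) -> cell a p = cell a' p'.
  by move=> e; congr elem_chain; apply: eq_prism => j;
    have [ea ep] := e j (ltn_ord j); rewrite ?ea ?ep.
pose B i k := cell (fun j => unbump k (bump i j)) (fun j => k < bump i j)%N.
pose G k := cell id (fun j => k <= j)%N.
transitivity (\sum_(k < n.+1) \sum_(i < n.+2) (-1) ^+ (k + i) *: B i k).
  rewrite linear_sum; apply: eq_bigr => k _; rewrite linearZ /=.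
  rewrite /boundary fglift1 /= scaler_sumr.
  by apply: eq_bigr => i _; rewrite scalerA -exprD face_prism.
have vertex_id x : vertex_map (fun j : 'I_n.+1 => inord j) x = x.
  by apply: vertex_map_id => j; rewrite inord_val.
(* The section [G k] is the image of s with the vertices from k on lifted to the
   top: it is the whole top for k = 0, and the bottom for k = n + 1. *)
have -> : << simplex_push psi (simplex_of T n s) >> = G 0.
  apply: (congr1 (@elem_chain n)); apply/continuousEP => x /=.
  rewrite /prism_fun vertex_id eta1 //=.
  by have [_] := set_mem (valP x).
have -> : << simplex_push phi (simplex_of T n s) >> = G n.+1.
  apply: (congr1 (@elem_chain n)); apply/continuousEP => x /=.
  rewrite /prism_fun vertex_id eta0 //= big1 // => j.
  by rewrite ltnNge -ltnS ltn_ord.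
apply: (@prism_cancellation K _ n
  (fun i k => cell (fun j => bump i (unbump k j)) (fun j => k < j)%N) B G)
  => [i k ik|k kn|k kn|i k ki];
  apply: eq_cell => j jn; rewrite /bump /unbump; split; lia.
Qed.

Lemma boundary_homotopy_operator (c : chain R K T) :
  boundary (homotopy_operator c) =
  push psi c - push phi c - homotopy_operator (boundary c).
Proof.
rewrite -[c]freeg_sumE !linear_sum -!big_split /=; apply: eq_bigr => s _.
have -> : << coeff s c *g s >> = coeff s c *: << s >>.
  by apply/eqP/freeg_eqP => t; rewrite coeffZ !coeffU mul1r.
rewrite !linearZ /= -!scalerDr; congr (_ *: _).
by rewrite {2}/boundary /homotopy_operator /push !fglift1 boundary_prism_chain.
Qed.

Lemma chains_in_homotopy_operator n (U : set T) (U' : set T') c :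
  (forall x t, U x -> U' (eta (x, t))) ->
  c \in chains_in n U -> homotopy_operator c \in chains_in (n + 1) U'.
Proof.
move=> UU' /chains_inP cU; rewrite -[c]freeg_sumE linear_sum.
rewrite big_seq rpred_sum // => s; rewrite mem_dom => /cU [tn sU].
rewrite /= /homotopy_operator liftU rpredZ // rpred_sum // => k _.
rewrite rpredZ //; apply/chains_inP => t; rewrite coeffU mul1r.
case: (eqVneq _ t) => [<- _|]; last by rewrite eqxx.
by split=> [|x]; [rewrite /= -tn -PoszD addn1|exact/UU'/sU].
Qed.

(** Homotopy invariance of relative singular homology: the representative c of a
    class has boundary in [P.2], and the prism operator splits the difference of
    its two images into the boundary of [homotopy_operator c] and a chain of
    [P'.2]. *)
Lemma hmap_push_homotopic n (P : set T * set T) (P' : set T' * set T')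
    (x : homology R K n P) :
  (forall y t, P.1 y -> P'.1 (eta (y, t))) ->
  (forall y t, P.2 y -> P'.2 (eta (y, t))) ->
  hmap (push phi) x = hmap (push psi) x :> homology R K n P'.
Proof.
move=> h1 h2; have I1 : `[(0 : R), 1]%classic 1 by rewrite /= in_itv /= ler01 lexx.
have I0 : `[(0 : R), 1]%classic 0 by rewrite /= in_itv /= ler01 lexx.
pose t0 : unit_interval R := exist _ 0 (mem_set I0).
pose t1 : unit_interval R := exist _ 1 (mem_set I1).
have [x1 x2] := rel_cyclesP _ _ _ (rep_in x).
apply/esym/clsP.
- by apply: rel_cycles_push (rep_in x) => y Py; rewrite -(eta1 y (t := t1)) //;
    [exact: h1|exact: h2].
- by apply: rel_cycles_push (rep_in x) => y Py; rewrite -(eta0 y (t := t0)) //;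
    [exact: h1|exact: h2].
apply/rel_boundariesP.
exists (homotopy_operator (rep x)), (homotopy_operator (boundary (rep x))); split.
- exact: chains_in_homotopy_operator x1.
- apply: (chains_in_mono (subrK 1 n) (fun _ => id)).
  exact: chains_in_homotopy_operator x2.
- by rewrite boundary_homotopy_operator subrK.
Qed.

End prism.

(** * Fiberwise homotopic morphisms *)

Lemma strip_module_hom_ext (R : realType) (K : fieldType) (G H : strip_module R K)
    (f g : strip_module_hom G H) : (forall u, f u =1 g u) -> f = g.
Proof.
case: f g => [f fl fn] [g gl gn] /= fg.
have {fg} e : f = g by apply: functional_extensionality_dep => u; exact/funext/fg.
by case: _ / e in gl gn *; congr MkStripModuleHom; exact: Prop_irrelevance.
Qed.

Theorem lemma3p1 (R : realType) (K : fieldType) (X Y : F0 R)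
    (phi psi : F0_hom X Y) :
  fiberwise_homotopic phi psi ->
  interlevel_homology_map K phi = interlevel_homology_map K psi.
Proof.
move=> [eta [etaA etaf eta0 eta1]]; apply: strip_module_hom_ext => u x.
apply: (hmap_push_homotopic eta0 eta1) => y t /=; rewrite etaf //.
by case=> [[/etaA yA yI]|yC]; [left|right].
Qed.
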